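(* Let $X_0\in\Gamma_1$, and assume that $\Gamma(a,b)$ contains no matrix with support included in $\mathrm{Supp}(X_0)$. Let $r$, $\{I_1,\dots,I_r\}$ and $\{J_1,\dots,J_r\}$ be the integer and the partitions associated with the iterative proportional fitting procedure started at $X_0$, as defined in the context. Fix $k\in\{1,\dots,r\}$, set $P=\{1,\dots,p\}\setminus(I_1\cup\dots\cup I_{k-1})$, $Q=\{1,\dots,q\}\setminus(J_1\cup\dots\cup J_{k-1})$, and consider the restricted problem associated to the marginals $a(\cdot|P)=(a_i/a(P))_{i\in P}$, $b(\cdot|Q)=(b_j/b(Q))_{j\in Q}$ and to the initial condition $(X_0(i,j))_{(i,j)\in P\times Q}$. If $k=r$, this restricted problem admits some solution. If $k<r$, the set $A_k\times B_k:=I_k\times(Q\setminus J_k)$ is a cause of incompatibility of this restricted problem. More precisely, among all causes of incompatibility $A\times B$ of this restricted problem maximizing the ratio $a(A)/b(Q\setminus B)$, it is the one which maximizes the set $A$ and minimizes the set $B$: $A_k\times B_k$ maximizes this ratio, and every cause of incompatibility $A\times B$ maximizing this ratio satisfies $A\subset A_k$ and $B\supset B_k$.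
   Context: Fix integers $p,q\ge 2$ and vectors $a=(a_1,\dots,a_p)$, $b=(b_1,\dots,b_q)$ with positive components such that $\sum_i a_i=\sum_j b_j=1$. For sets of indices $A,B$, $a(A)=\sum_{i\in A}a_i$, $b(B)=\sum_{j\in B}b_j$. For a $p\times q$ matrix $X$, set $X(i,+)=\sum_jX(i,j)$, $X(+,j)=\sum_iX(i,j)$, $R_i(X)=X(i,+)/a_i$, $C_j(X)=X(+,j)/b_j$. $\Gamma_0$ is the set of non-negative $p\times q$ matrices all of whose row sums and column sums are positive; $\Gamma_1$ is the set of $X\in\Gamma_0$ whose entries sum to $1$; $\Gamma(a,b)$ is the set of $X\in\Gamma_0$ with $X(i,+)=a_i$ for all $i$ and $X(+,j)=b_j$ for all $j$. $\mathrm{Supp}(X)=\{(i,j):X(i,j)>0\}$. Iterative proportional fitting procedure (IPFP): for $X\in\Gamma_0$ let $T_R(X)(i,j)=X(i,j)/R_i(X)$ and $T_C(X)(i,j)=X(i,j)/C_j(X)$; then $X_{2n+1}=T_R(X_{2n})$ and $X_{2n+2}=T_C(X_{2n+1})$ for all $n\ge0$. Definition of $r$, $I_k$, $J_k$: the limits $\lim_nR_i(X_{2n})$ and $\lim_nC_j(X_{2n+1})$ exist and are positive for all $i,j$. Let $\lambda_1<\dots<\lambda_r$ be the distinct values of $\lim_nR_i(X_{2n})$, $1\le i\le p$; then the distinct values of $\lim_nC_j(X_{2n+1})$, $1\le j\le q$, are $\lambda_1^{-1}>\dots>\lambda_r^{-1}$. Set $I_k=\{i:\lim_nR_i(X_{2n})=\lambda_k\}$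 and $J_k=\{j:\lim_nC_j(X_{2n+1})=\lambda_k^{-1}\}$. One has $\lambda_k=b(J_k)/a(I_k)$. Restricted problem: a solution is a non-negative matrix $S$ indexed by $P\times Q$ with row sums $a_i/a(P)$ ($i\in P$), column sums $b_j/b(Q)$ ($j\in Q$), and $S(i,j)=0$ whenever $X_0(i,j)=0$. A cause of incompatibility of the restricted problem is a product $A\times B$ with $A\subset P$, $B\subset Q$ non-empty, such that $X_0$ is null on $A\times B$ and $a(A)/a(P)>b(Q\setminus B)/b(Q)$. *)

(* Defs.v *)
From HB Require Import structures.
From mathcomp Require Import all_boot all_order all_algebra.
From mathcomp Require Import filter reals constructive_ereal topology normedtype.
From mathcomp Require Import sequences.

Set Implicit Arguments.
Unset Strict Implicit.
Unset Printing Implicit Defensive.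

Import Order.TTheory GRing.Theory Num.Theory.
Import numFieldNormedType.Exports.

Local Open Scope ring_scope.

Definition mass (R : realType) (n : nat) (c : 'I_n -> R) (A : {set 'I_n}) : R :=
  \sum_(i in A) c i.

Section Ipfp.
Variables (R : realType) (p q : nat) (a : 'I_p -> R) (b : 'I_q -> R).
Implicit Types (X S : 'M[R]_(p, q)) (P A : {set 'I_p}) (Q B : {set 'I_q}).

Definition row_sum X (i : 'I_p) : R := \sum_(j < q) X i j.
Definition col_sum X (j : 'I_q) : R := \sum_(i < p) X i j.

Definition row_ratio X (i : 'I_p) : R := row_sum X i / a i.
Definition col_ratio X (j : 'I_q) : R := col_sum X j / b j.

Definition Gamma0 X : Prop :=
  [/\ forall i j, 0 <= X i j, forall i, 0 < row_sum X i
    & forall j, 0 < col_sum X j].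

Definition Gamma1 X : Prop := Gamma0 X /\ \sum_(i < p) \sum_(j < q) X i j = 1.

Definition Gamma X : Prop :=
  [/\ Gamma0 X, forall i, row_sum X i = a i & forall j, col_sum X j = b j].

Definition Supp X : {set 'I_p * 'I_q} := [set ij | 0 < X ij.1 ij.2].

Definition T_R X : 'M[R]_(p, q) := \matrix_(i, j) (X i j / row_ratio X i).
Definition T_C X : 'M[R]_(p, q) := \matrix_(i, j) (X i j / col_ratio X j).

Fixpoint ipfp X0 (n : nat) : 'M[R]_(p, q) :=
  if n is m.+1 then
    if odd m then T_C (ipfp X0 m) else T_R (ipfp X0 m)
  else X0.

(* [limn] is total (its value is meaningful only for a convergent sequence);
   for X0 in Gamma1 and positive marginals of total mass 1 these sequences do
   converge, to positive limits. *)
Definition lim_row_ratio X0 (i : 'I_p) : R :=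
  limn (fun n : nat => row_ratio (ipfp X0 n.*2) i).
Definition lim_col_ratio X0 (j : 'I_q) : R :=
  limn (fun n : nat => col_ratio (ipfp X0 n.*2.+1) j).

(* Numbering starts at 0: the k-th term of this increasing sequence is
   lambda_(k+1), and likewise for [Iblock] and [Jblock]. *)
Definition lambdas X0 : seq R :=
  sort <=%R (undup [seq lim_row_ratio X0 i | i <- enum 'I_p]).

Definition nblocks X0 : nat := size (lambdas X0).

Definition Iblock X0 (k : nat) : {set 'I_p} :=
  [set i | lim_row_ratio X0 i == (lambdas X0)`_k].
Definition Jblock X0 (k : nat) : {set 'I_q} :=
  [set j | lim_col_ratio X0 j == ((lambdas X0)`_k)^-1].

Definition Prest X0 (k : nat) : {set 'I_p} := ~: \bigcup_(l < k) Iblock X0 l.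
Definition Qrest X0 (k : nat) : {set 'I_q} := ~: \bigcup_(l < k) Jblock X0 l.

(* A matrix indexed by P x Q is represented by the entries on P x Q of a p x q
   matrix, whose other entries are irrelevant. *)
Definition restricted_solution X0 P Q S : Prop :=
  [/\ forall i j, i \in P -> j \in Q -> 0 <= S i j,
      forall i, i \in P -> \sum_(j in Q) S i j = a i / mass a P,
      forall j, j \in Q -> \sum_(i in P) S i j = b j / mass b Q
    & forall i j, i \in P -> j \in Q -> X0 i j = 0 -> S i j = 0].

Definition incompatibility_cause X0 P Q A B : Prop :=
  [/\ A \subset P /\ A != set0, B \subset Q /\ B != set0,
      forall i j, i \in A -> j \in B -> X0 i j = 0
    & mass a A / mass a P > mass b (Q :\: B) / mass b Q].

(* Division in \bar R, where 0^-1 = +oo: the ratio is +oo when B = Q. *)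
Definition cause_ratio Q A B : \bar R :=
  ((mass a A)%:E / (mass b (Q :\: B))%:E)%E.

Definition ratio_maximizing_cause X0 P Q A B : Prop :=
  incompatibility_cause X0 P Q A B /\
  forall A' B', incompatibility_cause X0 P Q A' B' ->
    (cause_ratio Q A' B' <= cause_ratio Q A B)%E.

End Ipfp.

(* Main.v *)
Require Import Defs.
From HB Require Import structures.
From mathcomp Require Import all_boot all_order all_algebra.
From mathcomp Require Import filter reals constructive_ereal topology normedtype.
From mathcomp Require Import sequences.
From mathcomp Require boolp classical_sets.
From mathcomp Require Import derive realfun exp.
From mathcomp Require Import ring lra.

Set Implicit Arguments.
Unset Strict Implicit.
Unset Printing Implicit Defensive.

Import Order.TTheory GRing.Theory Num.Theory.
Import numFieldNormedType.Exports.

Local Open Scope ring_scope.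

(** Everything follows from one non-negative matrix S supported in Supp(X0), with
    row sums a, that minimizes sum_j S(+,j)^2 / b_j.  Put v_j = S(+,j) / b_j.
    Moving a little mass of S inside a row, from a column to another one allowed
    by X0, cannot lower the energy; hence S(i,j) > 0 and X0(i,j') > 0 imply
    v_j <= v_j'.  So on row i the function v is constant on the support of S, and
    calling 1 / u_i this constant one gets u_i v_j = 1 on Supp(S) and
    u_i v_j >= 1 on Supp(X0).  This is the record [equilibrium]; it exists by
    compactness and first-order optimality ([energy_minimizer],
    [minimizer_balanced], [exists_equilibrium]).

    The pair (u, v) is the pair of limits of the fitting procedure.  The
    potential Phi_n = sum S(i,j) ln X_{2n}(i,j) is bounded above, and since
    u_i v_j = 1 on Supp(S) its increments are
      sum_i a_i (- ln (R_i / u_i)) + sum_j b_j v_j (- ln (C_j / v_j)).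
    For n >= 1 the mean of R_i / u_i with weights a_i is at most 1, because
    u_i v_j >= 1 on Supp(X0) and the column sums of X_{2n} are b; the mean of
    C_j / v_j with weights b_j v_j is 1, because S and X_{2n+1} have mass 1.  So
    by concavity of ln both sums are non-negative, and they control the distance
    of each ratio to 1.  The increments of a bounded monotone sequence vanish,
    hence R_i(X_{2n}) -> u_i and C_j(X_{2n+1}) -> v_j ([row_ratio_cvg],
    [col_ratio_cvg]).

    The claims on the blocks are then mass balances for S.  With l = lambda_k,
    P = {u >= l}, Q = {v <= 1/l}, I_k = {u = l}, J_k = {v = 1/l}, the matrix S
    sends P exactly to Q and I_k exactly to J_k.  If X0 is null on A x B, then
    the mass a(A) is sent into Q \ B, where v <= 1/l, so a(A) <= b(Q \ B) / l,
    with equality only if v = 1/l on Q \ B, and then u = l on A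
    ([null_mass_le], [null_mass_eq]).  The rectangle I_k x (Q \ J_k) reaches
    equality, and for the last block the restriction of S / a(P) solves the
    restricted problem. *)

(** * Finite sums and sorted sequences *)

Lemma sumr_gt0P (R : realType) (I : finType) (P : pred I) (F : I -> R) :
  (forall i, P i -> 0 <= F i) ->
  reflect (exists2 i, P i & 0 < F i) (0 < \sum_(i | P i) F i).
Proof.
move=> F_ge0; apply: (iffP idP) => [|[i Pi Fi_gt0]].
  rewrite lt0r psumr_neq0// => /andP[/hasP[i _ /andP[Pi Fi]] _].
  by exists i.
by rewrite (bigD1 i)//= ltr_pwDl// sumr_ge0// => j /andP[/F_ge0].
Qed.

Lemma ltr_sum_one (R : realType) (I : finType) (A : {set I}) (F G : I -> R) i :
    i \in A -> F i < G i -> (forall k, k \in A -> F k <= G k) ->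
  \sum_(k in A) F k < \sum_(k in A) G k.
Proof.
move=> iA lt_i le_k; rewrite (bigD1 i)//= [ltRHS](bigD1 i)//=.
by apply: ltr_leD => //; apply: ler_sum => k /andP[/le_k].
Qed.

Lemma mass_gt0 (R : realType) (n : nat) (c : 'I_n -> R) (A : {set 'I_n}) i :
  (forall k, 0 < c k) -> i \in A -> 0 < mass c A.
Proof.
move=> c_gt0 iA; apply/sumr_gt0P => [k _|]; first exact: ltW.
by exists i.
Qed.

Lemma sum_kronecker (R : realType) (n : nat) (j : 'I_n) (g : 'I_n -> R) :
  \sum_l (l == j)%:R * g l = g j.
Proof.
rewrite (bigD1 j)//= eqxx mul1r big1 ?addr0// => l /negPf->.
by rewrite mul0r.
Qed.

(** This is how the sets left after removing the first k blocks become upper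
    level sets of the limits. *)
Lemma lt_sorted_nth_le (R : realType) (s : seq R) (k : nat) (x : R) :
    sorted <%R s -> (k < size s)%N -> x \in s ->
  reflect (forall l, (l < k)%N -> x != s`_l) (s`_k <= x).
Proof.
move=> s_lt k_lt x_s; have m_lt : (index x s < size s)%N by rewrite index_mem.
apply: (iffP idP) => [x_ge m mk|x_neq].
  rewrite gt_eqF//; apply: lt_le_trans x_ge.
  by rewrite lt_sorted_ltn_nth// inE (ltn_trans mk).
rewrite -[leRHS](nth_index 0 x_s) lt_sorted_leq_nth// leqNgt.
by apply/negP => /x_neq; rewrite nth_index// eqxx.
Qed.

(** * Logarithmic estimates and limits *)

Section Analysis.
Import boolp classical_sets.
Local Open Scope classical_set_scope.
Local Open Scope ring_scope.
Variable R : realType.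
Implicit Types (t : R).

(** The concavity gap of ln at 1 is turned into a square, from which convergence
    to 1 can be read off: apply ln s <= s - 1 at s = sqrt t. *)
Lemma sqr_sqrt_sub1_le t : 0 < t -> (Num.sqrt t - 1) ^+ 2 <= t - 1 - ln t.
Proof.
move=> t_gt0; have s_gt0 : 0 < Num.sqrt t by rewrite sqrtr_gt0.
have tE : t = Num.sqrt t ^+ 2 by rewrite sqr_sqrtr// ltW.
have lnE : ln t = ln (Num.sqrt t) *+ 2 by rewrite {1}tE lnXn.
have le_ln : ln (Num.sqrt t) <= Num.sqrt t - 1.
  have /le_ln1Dx : -1 < Num.sqrt t - 1 by lra.
  by rewrite addrC subrK.
rewrite lnE {2}tE; lra.
Qed.

(** A family of positive numbers with weighted mean at most 1 has a non-positive
    mean logarithm, and this mean vanishes only near the constant family 1: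
    adding the non-positive term sum w_i (t_i - 1) leaves a sum of the gaps
    t_i - 1 - ln t_i, each of which is bounded by the total. *)
Lemma weighted_ln_gap (n : nat) (w t : 'I_n -> R) :
    (forall i, 0 < w i) -> (forall i, 0 < t i) ->
    \sum_i w i * t i <= \sum_i w i ->
  0 <= \sum_i w i * - ln (t i) /\
  forall i, (Num.sqrt (t i) - 1) ^+ 2 <= (w i)^-1 * \sum_i w i * - ln (t i).
Proof.
move=> w_gt0 t_gt0 mean_le1.
have gap_ge0 i : 0 <= w i * (t i - 1 - ln (t i)).
  rewrite mulr_ge0 ?(ltW (w_gt0 _))//.
  exact: le_trans (sqr_ge0 _) (sqr_sqrt_sub1_le (t_gt0 i)).
have gap_le : \sum_i w i * (t i - 1 - ln (t i)) <= \sum_i w i * - ln (t i).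
  under eq_bigr do rewrite mulrDr mulrBr mulr1.
  by rewrite big_split sumrB /= gerDr subr_le0.
split=> [|i]; first by apply: le_trans gap_le; apply: sumr_ge0.
apply: le_trans (sqr_sqrt_sub1_le (t_gt0 i)) _.
rewrite mulrC ler_pdivlMr// mulrC; apply: le_trans gap_le.
by rewrite (bigD1 i)//= lerDl sumr_ge0.
Qed.

Lemma cvg_sqrt_sub1 (t d : nat -> R) (c : R) :
    (forall n, 0 < t n) -> (forall n, (Num.sqrt (t n) - 1) ^+ 2 <= c * d n) ->
    d n @[n --> \oo] --> (0 : R) ->
  t n @[n --> \oo] --> (1 : R).
Proof.
move=> t_gt0 le_d d0.
have cd0 : (Num.sqrt (c * d n) @[n --> \oo] --> (0 : R)).
  rewrite -[X in _ --> X]sqrtr0; apply: continuous_cvg.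
    exact: sqrt_continuous.
  by rewrite -[X in _ --> X](mulr0 c); apply: cvgMl_tmp.
have s1 : (Num.sqrt (t n) @[n --> \oo] --> (1 : R)).
  apply/cvgrPdist_le => /= e e_gt0.
  move/cvgrPdist_le: cd0 => /(_ e e_gt0); apply: filterS => n /=.
  rewrite sub0r normrN ger0_norm ?sqrtr_ge0//; apply: le_trans.
  by rewrite distrC -sqrtr_sqr ler_wsqrtr.
have -> : t = (fun n => Num.sqrt (t n) * Num.sqrt (t n)).
  by apply/funext => n; rewrite -expr2 sqr_sqrtr// ltW.
by rewrite -[X in _ --> X](mulr1 1); apply: cvgM.
Qed.

Lemma increment_cvg0 (f : nat -> R) (M : R) :
  (forall n, f n <= f n.+1) -> (forall n, f n <= M) ->
  f n.+1 - f n @[n --> \oo] --> (0 : R).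
Proof.
move=> f_nd f_le.
have /cvg_ex[l fl] : cvgn f.
  apply: nondecreasing_is_cvgn; first exact/nondecreasing_seqP.
  by exists M => _ [n _ <-].
rewrite -(subrr l); apply: cvgB => //.
by have := fl; rewrite -cvg_shiftS.
Qed.

End Analysis.

(** * Equilibria and the elementary steps of the procedure *)

Section Ipfp.
Variables (R : realType) (p q : nat) (a : 'I_p -> R) (b : 'I_q -> R).
Hypotheses (a_gt0 : forall i, 0 < a i) (b_gt0 : forall j, 0 < b j).
Implicit Types (X S : 'M[R]_(p, q)) (u : 'I_p -> R) (v : 'I_q -> R).

(** [u] and [v] are the future limits of the row and column ratios; [S] is a
    transport plan certifying them, and it uses only the cells of [X] on which
    u_i v_j attains its minimum 1. *)
Record equilibrium X S u v : Prop := Equilibrium {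
  row_limit_gt0 : forall i, 0 < u i;
  col_limit_gt0 : forall j, 0 < v j;
  flow_ge0 : forall i j, 0 <= S i j;
  flow_supp : forall i j, S i j != 0 -> X i j != 0;
  flow_tight : forall i j, S i j != 0 -> u i * v j = 1;
  supp_ge1 : forall i j, X i j != 0 -> 1 <= u i * v j;
  flow_row : forall i, row_sum S i = a i;
  flow_col : forall j, col_sum S j = b j * v j }.

Lemma row_ratio_gt0 X i : Gamma0 X -> 0 < row_ratio a X i.
Proof. by case=> _ r_gt0 _; rewrite divr_gt0. Qed.

Lemma col_ratio_gt0 X j : Gamma0 X -> 0 < col_ratio b X j.
Proof. by case=> _ _ c_gt0; rewrite divr_gt0. Qed.

Lemma Gamma0_scale X (w : 'I_p -> 'I_q -> R) :
    Gamma0 X -> (forall i j, 0 < w i j) ->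
  Gamma0 (\matrix_(i, j) (X i j / w i j)).
Proof.
move=> [X_ge0 r_gt0 c_gt0] w_gt0; split=> [i j|i|j].
- by rewrite mxE divr_ge0// ltW.
- have /sumr_gt0P[//|j _ Xij] := r_gt0 i.
  apply/sumr_gt0P => [j' _|]; first by rewrite mxE divr_ge0// ltW.
  by exists j; rewrite // mxE divr_gt0.
- have /sumr_gt0P[//|i _ Xij] := c_gt0 j.
  apply/sumr_gt0P => [i' _|]; first by rewrite mxE divr_ge0// ltW.
  by exists i; rewrite // mxE divr_gt0.
Qed.

Lemma Gamma0_T_R X : Gamma0 X -> Gamma0 (T_R a X).
Proof. by move=> gX; apply: Gamma0_scale => // i _; apply: row_ratio_gt0. Qed.

Lemma Gamma0_T_C X : Gamma0 X -> Gamma0 (T_C b X).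
Proof. by move=> gX; apply: Gamma0_scale => // _ j; apply: col_ratio_gt0. Qed.

Lemma row_sum_T_R X i : Gamma0 X -> row_sum (T_R a X) i = a i.
Proof.
move=> [_ r_gt0 _]; rewrite /row_sum; under eq_bigr do rewrite mxE.
by rewrite -mulr_suml -/(row_sum X i) invf_div mulrCA divff ?mulr1 ?gt_eqF.
Qed.

Lemma col_sum_T_C X j : Gamma0 X -> col_sum (T_C b X) j = b j.
Proof.
move=> [_ _ c_gt0]; rewrite /col_sum; under eq_bigr do rewrite mxE.
by rewrite -mulr_suml -/(col_sum X j) invf_div mulrCA divff ?mulr1 ?gt_eqF.
Qed.

Lemma ipfp_odd X n : ipfp a b X n.*2.+1 = T_R a (ipfp a b X n.*2).
Proof. by rewrite /= odd_double. Qed.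

Lemma ipfp_even X n : ipfp a b X n.+1.*2 = T_C b (ipfp a b X n.*2.+1).
Proof. by rewrite doubleS /= odd_double. Qed.

Lemma Gamma0_ipfp X n : Gamma0 X -> Gamma0 (ipfp a b X n).
Proof.
move=> gX; elim: n => //= n IHn.
by case: odd; [apply: Gamma0_T_C|apply: Gamma0_T_R].
Qed.

Lemma ipfp_neq0 X n i j : Gamma0 X -> (ipfp a b X n i j != 0) = (X i j != 0).
Proof.
move=> gX; elim: n => //= n <-.
have gXn := Gamma0_ipfp n gX.
case: odd; rewrite mxE mulf_eq0 invr_eq0 [X in _ || X]gt_eqF ?orbF//.
  exact: col_ratio_gt0.
exact: row_ratio_gt0.
Qed.

(** * Existence of an equilibrium *)

Definition flows X (S : 'M[R]_(p, q)) : Prop :=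
  [/\ forall i j, 0 <= S i j, forall i j, S i j != 0 -> X i j != 0
    & forall i, row_sum S i = a i].

(** The b-weighted square norm of the column ratios, a strictly convex measure of
    their imbalance. *)
Definition energy (S : 'M[R]_(p, q)) : R := \sum_j col_sum S j ^+ 2 / b j.

Section Minimizer.
Import boolp classical_sets.
Local Open Scope classical_set_scope.
Local Open Scope ring_scope.

Lemma vec_mx_continuous i j :
  continuous (fun z : 'rV[R]_(p * q) => vec_mx z i j).
Proof.
have -> : (fun z : 'rV[R]_(p * q) => vec_mx z i j) =
    (fun z => z 0 (mxvec_index i j)) by apply/funext => z; rewrite mxE.
exact: coord_continuous.
Qed.

Lemma continuous_sumr (T : topologicalType) (I : finType) (f : I -> T -> R) :
  (forall i, continuous (f i)) -> continuous (fun x => \sum_i f i x).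
Proof.
move=> f_cont x; apply: cvg_big => [|i _]; first exact: add_continuous.
exact: f_cont.
Qed.

Lemma continuous_sqrM (T : topologicalType) (f : T -> R) (k : R) :
  continuous f -> continuous (fun x => f x ^+ 2 * k).
Proof.
move=> f_cont x; apply: cvgM; last exact: cvg_cst.
by apply: cvgM; apply: f_cont.
Qed.

(** The support constraint and the bounds a_i <= 1 amount to a product of
    segments, degenerate outside the support of [X]; only the row sums are an
    additional closed condition. *)
Lemma flows_compact X :
  (forall i, a i <= 1) -> compact [set z : 'rV[R]_(p * q) | flows X (vec_mx z)].
Proof.
move=> a_le1.
pose cap := mxvec (\matrix_(i, j) ((X i j != 0)%:R : R)).
pose box := [set z : 'rV[R]_(p * q) | forall k, z ord0 k \in `[0, cap 0 k]].
pose rows := \bigcap_(i in [set: 'I_p])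
  ((fun z : 'rV[R]_(p * q) => row_sum (vec_mx z) i) @^-1` [set x | x = a i]).
have -> : [set z | flows X (vec_mx z)] = box `&` rows.
  apply/seteqP; split=> z /=.
    move=> [z_ge0 z_supp z_row]; split=> [k|i _]; last exact: z_row.
    case/mxvec_indexP: k => i j; rewrite /= in_itv /= mxvecE mxE.
    have := z_ge0 i j; have := z_supp i j; have := z_row i.
    rewrite mxE => rowi suppij ->/=.
    have [X0|_] := eqVneq (X i j) 0.
      have [->//|/suppij] := eqVneq (z ord0 (mxvec_index i j)) 0.
      by rewrite X0 eqxx.
    apply: le_trans (a_le1 i); rewrite -rowi /row_sum (bigD1 j)//= mxE lerDl.
    by rewrite sumr_ge0// => j' _; apply: z_ge0.
  move=> [z_box z_row]; split=> [i j|i j|i]; last exact: z_row.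
    by have := z_box (mxvec_index i j); rewrite /= in_itv /= mxE => /andP[].
  have := z_box (mxvec_index i j); rewrite /= in_itv /= mxvecE !mxE.
  by have [_|//] := eqVneq (X i j) 0; rewrite -eq_le eq_sym => ->.
apply: compact_closedI.
  apply: (@rV_compact _ _ (fun k => `[0, cap 0 k]%classic)) => k.
  exact: segment_compact.
apply: closed_bigI => i _; apply: preimage_closed; last exact: closed_eq.
move=> z _; apply: continuous_sumr => j; exact: vec_mx_continuous.
Qed.

Lemma energy_minimizer X : Gamma0 X -> (forall i, a i <= 1) ->
  exists2 S, flows X S & forall S', flows X S' -> energy S <= energy S'.
Proof.
move=> gX a_le1.
pose E := fun z : 'rV[R]_(p * q) => energy (vec_mx z).
have E_cont : continuous E.
  apply: continuous_sumr => j; apply: continuous_sqrM.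
  by apply: continuous_sumr => i; apply: vec_mx_continuous.
have nonempty : [set z | flows X (vec_mx z)] !=set0.
  exists (mxvec (T_R a X)) => /=; rewrite mxvecK.
  have [T_ge0 _ _] := Gamma0_T_R gX.
  split=> // [i j|i]; last exact: row_sum_T_R.
  by rewrite mxE mulf_eq0 negb_or => /andP[].
have [z] := compact_EVT_min nonempty (flows_compact a_le1)
  (continuous_subspaceT E_cont).
rewrite inE /= => flow_v z_min; exists (vec_mx z) => // S' flow_S'.
by have := z_min (mxvec S'); rewrite inE /= /E mxvecK; apply.
Qed.

End Minimizer.

Definition reroute (S : 'M[R]_(p, q)) (i : 'I_p) (j j' : 'I_q) (e : R) :=
  S + e *: (delta_mx i j' - delta_mx i j).

Lemma row_sum_reroute S i j j' e i' :
  row_sum (reroute S i j j' e) i' = row_sum S i'.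
Proof.
rewrite /row_sum; under eq_bigr do rewrite !mxE.
rewrite big_split -mulr_sumr sumrB /=.
have dE k : \sum_l ((i' == i) && (l == k))%:R = (i' == i)%:R :> R.
  rewrite (bigD1 k)//= eqxx andbT big1 ?addr0// => l /negPf->.
  by rewrite andbF.
by rewrite !dE subrr mulr0 addr0.
Qed.

Lemma col_sum_reroute S i j j' e l :
  col_sum (reroute S i j j' e) l = col_sum S l + e * ((l == j')%:R - (l == j)%:R).
Proof.
rewrite /col_sum; under eq_bigr do rewrite !mxE.
rewrite big_split -mulr_sumr sumrB /=; congr (_ + _ * (_ - _)).
  by rewrite (bigD1 i)//= eqxx big1 ?addr0// => k /negPf->.
by rewrite (bigD1 i)//= eqxx big1 ?addr0// => k /negPf->.
Qed.

Lemma energy_reroute S i j j' e : j != j' ->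
  energy (reroute S i j j' e) = energy S
    + (e *+ 2 * (col_ratio b S j' - col_ratio b S j)
       + e ^+ 2 * ((b j')^-1 + (b j)^-1)).
Proof.
move=> jj'; rewrite /energy; under eq_bigr do rewrite col_sum_reroute.
pose g l := e *+ 2 * col_ratio b S l.
pose h l := e ^+ 2 * (b l)^-1.
transitivity (\sum_l (col_sum S l ^+ 2 / b l
    + ((l == j')%:R * (g l + h l) + (l == j)%:R * (h l - g l)))).
  apply: eq_bigr => l _; rewrite /g /h /col_ratio.
  have [->|lj] := eqVneq l j; last by case: eqVneq => _ /=; ring.
  by rewrite (negPf jj') /=; ring.
rewrite !big_split /= !sum_kronecker /g /h; ring.
Qed.

(** First-order optimality: if row [i] used a column [j] with a larger ratio than
    an available column [j'], rerouting a little mass from [j] to [j'] would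
    lower the energy. *)
Lemma minimizer_balanced X S : flows X S ->
    (forall S', flows X S' -> energy S <= energy S') ->
  forall i j j', S i j != 0 -> X i j' != 0 ->
  col_ratio b S j <= col_ratio b S j'.
Proof.
move=> [S_ge0 S_supp S_row] S_min i j j' Sij Xij'; rewrite leNgt.
apply/negP => lt_load.
have jj' : j != j' by apply: contraTneq lt_load => ->; rewrite ltxx.
set gap := col_ratio b S j - col_ratio b S j'.
have gap_gt0 : 0 < gap by rewrite subr_gt0.
pose B := (b j')^-1 + (b j)^-1.
have B_gt0 : 0 < B by rewrite addr_gt0 ?invr_gt0.
have Sij_gt0 : 0 < S i j by rewrite lt0r Sij S_ge0.
(* [e <= S i j] keeps the entries non-negative; [e <= gap / B] makes the
   quadratic term at most half of the linear gain. *)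
pose e := Num.min (S i j) (gap / B).
have e_gt0 : 0 < e by rewrite lt_min Sij_gt0 divr_gt0.
have e_le : e <= S i j by rewrite ge_min lexx.
have eB_le : e * B <= gap by rewrite -ler_pdivlMr// ge_min lexx orbT.
have : flows X (reroute S i j j' e).
  split=> [k l|k l|k]; last by rewrite row_sum_reroute.
    rewrite !mxE; have [->|_] := eqVneq k i; last by rewrite subrr mulr0 addr0.
    have [->|_] := eqVneq l j; rewrite /= ?(negPf jj').
      by rewrite sub0r mulrN1 subr_ge0.
    by rewrite subr0 addr_ge0 ?mulr_ge0 ?ler0n ?(ltW e_gt0).
  rewrite !mxE; have [->|_] := eqVneq k i; last first.
    by rewrite subrr mulr0 addr0; apply: S_supp.
  have [-> //|_] := eqVneq l j'.
  have [-> _|_] := eqVneq l j; first exact: S_supp.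
  by rewrite subrr mulr0 addr0; apply: S_supp.
move/S_min; rewrite energy_reroute// lerDl -/B.
have : 0 < e * (gap *+ 2 - e * B) by rewrite mulr_gt0// mulr2n; lra.
rewrite /gap; nra.
Qed.

(** [v] is the column ratio of a minimizer and [1 / u i] the common value of [v]
    on the columns used by row [i].  It is positive: each column is reachable
    from some row, and the columns this row uses carry mass but have no larger
    ratio. *)
Lemma exists_equilibrium X : Gamma0 X -> (forall i, a i <= 1) ->
  exists S u v, equilibrium X S u v.
Proof.
move=> gX a_le1; have [S flowS S_min] := energy_minimizer gX a_le1.
have balanced := minimizer_balanced flowS S_min.
have [S_ge0 S_supp S_row] := flowS; have [X_ge0 _ Xcol_gt0] := gX.
have target i : exists j, S i j != 0.
  have : 0 < row_sum S i by rewrite S_row.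
  by move=> /sumr_gt0P[//|j _ Sij]; exists j; rewrite gt_eqF.
have [t St] := boolp.choice target.
have colE j : col_sum S j = b j * col_ratio b S j.
  by rewrite mulrC divfK// gt_eqF.
have t_gt0 i : 0 < col_ratio b S (t i).
  rewrite divr_gt0//; apply/sumr_gt0P => //.
  by exists i; rewrite // lt0r St S_ge0.
exists S, (fun i => (col_ratio b S (t i))^-1), (col_ratio b S); split=> //.
- by move=> i; rewrite invr_gt0.
- move=> j; have /sumr_gt0P[//|i _ Xij] := Xcol_gt0 j.
  by apply: lt_le_trans (t_gt0 i) _; apply: balanced => //; rewrite gt_eqF.
- move=> i j Sij; have -> : col_ratio b S j = col_ratio b S (t i).
    by apply/eqP; rewrite eq_le !(balanced i)// S_supp.
  by rewrite mulVf ?gt_eqF.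
- move=> i j Xij; rewrite mulrC ler_pdivlMr// mul1r.
  exact: balanced.
Qed.

(** * Convergence of the procedure *)

Section Convergence.
Import boolp classical_sets.
Local Open Scope classical_set_scope.
Local Open Scope ring_scope.
Variables (X S : 'M[R]_(p, q)) (u : 'I_p -> R) (v : 'I_q -> R).
Hypotheses (gX : Gamma0 X) (eqS : equilibrium X S u v) (a_sum1 : \sum_i a i = 1)
  (b_sum1 : \sum_j b j = 1).

Let x n := ipfp a b X n.*2.
Let y n := ipfp a b X n.*2.+1.
Let r n i := row_ratio a (x n) i / u i.
Let c n j := col_ratio b (y n) j / v j.

Let gx n : Gamma0 (x n). Proof. exact: Gamma0_ipfp. Qed.
Let gy n : Gamma0 (y n). Proof. exact: Gamma0_ipfp. Qed.

Let r_gt0 n i : 0 < r n i.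
Proof. by rewrite divr_gt0 ?row_ratio_gt0 ?(row_limit_gt0 eqS). Qed.

Let c_gt0 n j : 0 < c n j.
Proof. by rewrite divr_gt0 ?col_ratio_gt0 ?(col_limit_gt0 eqS). Qed.

Let x_col n j : col_sum (x n.+1) j = b j.
Proof. by rewrite /x ipfp_even; exact: col_sum_T_C (gy n). Qed.

Let y_row n i : row_sum (y n) i = a i.
Proof. by rewrite /y ipfp_odd; exact: row_sum_T_R (gx n). Qed.

Lemma flow_mass : \sum_j b j * v j = 1.
Proof.
under eq_bigr do rewrite -(flow_col eqS).
rewrite /col_sum exchange_big -a_sum1 /=; apply: eq_bigr => i _.
exact: (flow_row eqS).
Qed.

(** Here u_i v_j >= 1 on the support of [X] is used: 1 / u_i <= v_j turns the row
    average into a sum of column sums, which are known after a column step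
    (whence the index [n.+1]). *)
Lemma row_mean_le1 n : \sum_i a i * r n.+1 i <= \sum_i a i.
Proof.
have -> : \sum_i a i * r n.+1 i = \sum_i \sum_j x n.+1 i j / u i.
  apply: eq_bigr => i _.
  rewrite -mulr_suml /r /row_ratio mulrA mulrCA divff ?mulr1//.
  by rewrite gt_eqF.
rewrite a_sum1 -flow_mass exchange_big /=; apply: ler_sum => j _.
rewrite -(x_col n) mulr_suml; apply: ler_sum => i _.
have [x0|] := eqVneq (x n.+1 i j) 0; first by rewrite x0 !mul0r.
have [x_ge0 _ _] := gx n.+1.
rewrite ipfp_neq0// => /(supp_ge1 eqS) uv_ge1; rewrite ler_wpM2l//.
by rewrite -[leLHS]mul1r ler_pdivrMr ?(row_limit_gt0 eqS)// mulrC.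
Qed.

Lemma col_mean_le1 n : \sum_j (b j * v j) * c n j <= \sum_j b j * v j.
Proof.
have -> : \sum_j (b j * v j) * c n j = \sum_j col_sum (y n) j.
  apply: eq_bigr => j _; rewrite /c /col_ratio.
  by field; rewrite !gt_eqF// (col_limit_gt0 eqS).
rewrite flow_mass -a_sum1 exchange_big /=; apply: ler_sum => i _.
by rewrite -/(row_sum (y n) i) y_row.
Qed.

Let Phi n := \sum_i \sum_j S i j * ln (x n i j).
Let dR n := \sum_i a i * - ln (r n i).
Let dC n := \sum_j (b j * v j) * - ln (c n j).

(** As u_i v_j = 1 where [S] does not vanish, dividing an entry by R_i C_j is the
    same as dividing it by (R_i / u_i) (C_j / v_j). *)
Lemma potential_step n : Phi n.+1 - Phi n = dR n + dC n.
Proof.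
have -> : dC n = \sum_i \sum_j S i j * - ln (c n j).
  rewrite exchange_big; apply: eq_bigr => j _.
  by rewrite -(flow_col eqS) mulr_suml.
have -> : dR n = \sum_i \sum_j S i j * - ln (r n i).
  by apply: eq_bigr => i _; rewrite -(flow_row eqS) mulr_suml.
rewrite -sumrB -big_split; apply: eq_bigr => i _.
rewrite -sumrB -big_split; apply: eq_bigr => j _ /=.
have [->|Sij] := eqVneq (S i j) 0; first by rewrite !mul0r subr0 addr0.
rewrite -mulrBr -mulrDr; congr (_ * _).
have xij : 0 < x n i j.
  have [x_ge0 _ _] := gx n.
  by rewrite lt0r x_ge0 ipfp_neq0// (flow_supp eqS).
have -> : x n.+1 i j = x n i j / r n i / c n j.
  rewrite {1}/x ipfp_even ipfp_odd !mxE -/(x n) -ipfp_odd -/(y n).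
  have uv1 := flow_tight eqS Sij.
  have [u0 v0] := (row_limit_gt0 eqS i, col_limit_gt0 eqS j).
  rewrite -[LHS]mulr1 -uv1 /r /c; field.
  by rewrite !gt_eqF ?row_ratio_gt0 ?col_ratio_gt0.
rewrite (@ln_div _ (x n i j / r n i) (c n j)) ?posrE ?(divr_gt0 xij (r_gt0 n i))//.
by rewrite (@ln_div _ (x n i j) (r n i)) ?posrE//; ring.
Qed.

Lemma potential_le0 n : Phi n.+1 <= 0.
Proof.
apply: sumr_le0 => i _; apply: sumr_le0 => j _.
rewrite mulr_ge0_le0 ?(flow_ge0 eqS)// ln_le0//.
have [x_ge0 _ _] := gx n.+1.
apply: (@le_trans _ _ (b j)).
  rewrite -(x_col n).
  by rewrite /col_sum (bigD1 i)//= lerDl sumr_ge0.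
by rewrite -b_sum1 (bigD1 j)//= lerDl sumr_ge0// => k _; rewrite ltW.
Qed.

Lemma flow_col_gt0 j : 0 < b j * v j.
Proof. by rewrite mulr_gt0// (col_limit_gt0 eqS). Qed.

Lemma row_step_ge0 n : 0 <= dR n.+1.
Proof. by have [] := weighted_ln_gap a_gt0 (r_gt0 n.+1) (row_mean_le1 n). Qed.

Lemma col_step_ge0 n : 0 <= dC n.
Proof.
by have [] := weighted_ln_gap flow_col_gt0 (c_gt0 n) (col_mean_le1 n).
Qed.

Lemma potential_step_cvg0 :
  dR n.+1 + dC n.+1 @[n --> \oo] --> (0 : R).
Proof.
have -> : (fun n => dR n.+1 + dC n.+1) = (fun n => Phi n.+2 - Phi n.+1).
  by apply/funext => n; rewrite potential_step.
apply: (@increment_cvg0 _ (fun n => Phi n.+1) 0) => n; last exact: potential_le0.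
by rewrite -subr_ge0 potential_step addr_ge0 ?row_step_ge0 ?col_step_ge0.
Qed.

Lemma row_ratio_cvg i : row_ratio a (x n) i @[n --> \oo] --> u i.
Proof.
have r1 : r n.+1 i @[n --> \oo] --> (1 : R).
  apply: (cvg_sqrt_sub1 (c := (a i)^-1) _ _ potential_step_cvg0) => // n.
  have [_ /(_ i)] := weighted_ln_gap a_gt0 (r_gt0 n.+1) (row_mean_le1 n).
  by move/le_trans; apply; rewrite ler_pM2l ?invr_gt0// lerDl col_step_ge0.
rewrite -(cvg_shiftS (fun n => row_ratio a (x n) i)) /=.
have -> : (fun n => row_ratio a (x n.+1) i) = (fun n => r n.+1 i * u i).
  by apply/funext => n; rewrite divfK// gt_eqF// (row_limit_gt0 eqS).
have : r n.+1 i * u i @[n --> \oo] --> 1 * u i by apply: cvgMr_tmp.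
by rewrite mul1r.
Qed.

Lemma col_ratio_cvg j : col_ratio b (y n) j @[n --> \oo] --> v j.
Proof.
have c1 : c n.+1 j @[n --> \oo] --> (1 : R).
  apply: (cvg_sqrt_sub1 (c := (b j * v j)^-1) _ _ potential_step_cvg0) => // n.
  have [_ /(_ j)] :=
    weighted_ln_gap flow_col_gt0 (c_gt0 n.+1) (col_mean_le1 n.+1).
  move/le_trans; apply; rewrite ler_pM2l ?invr_gt0 ?flow_col_gt0//.
  by rewrite lerDr row_step_ge0.
rewrite -(cvg_shiftS (fun n => col_ratio b (y n) j)) /=.
have -> : (fun n => col_ratio b (y n.+1) j) = (fun n => c n.+1 j * v j).
  by apply/funext => n; rewrite divfK// gt_eqF// (col_limit_gt0 eqS).
have : c n.+1 j * v j @[n --> \oo] --> 1 * v j by apply: cvgMr_tmp.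
by rewrite mul1r.
Qed.

Lemma lim_row_ratioE i : lim_row_ratio a b X i = u i.
Proof. by apply/cvg_lim => //; apply: row_ratio_cvg. Qed.

Lemma lim_col_ratioE j : lim_col_ratio a b X j = v j.
Proof. by apply/cvg_lim => //; apply: col_ratio_cvg. Qed.

End Convergence.

(** * Blocks and causes of incompatibility *)

Section Blocks.
Variables (X S : 'M[R]_(p, q)) (u : 'I_p -> R) (v : 'I_q -> R).
Hypothesis eqS : equilibrium X S u v.

Lemma row_target i : exists j, S i j != 0.
Proof.
have : 0 < row_sum S i by rewrite (flow_row eqS).
move=> /sumr_gt0P[j _|j _ Sij]; first exact: (flow_ge0 eqS).
by exists j; rewrite gt_eqF.
Qed.

Lemma col_source j : exists i, S i j != 0.
Proof.
have : 0 < col_sum S j by rewrite (flow_col eqS) mulr_gt0// (col_limit_gt0 eqS).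
move=> /sumr_gt0P[i _|i _ Sij]; first exact: (flow_ge0 eqS).
by exists i; rewrite gt_eqF.
Qed.

Lemma flow_colE i j : S i j != 0 -> v j = (u i)^-1.
Proof.
move=> /(flow_tight eqS) uv1; apply: (mulfI (lt0r_neq0 (row_limit_gt0 eqS i))).
by rewrite uv1 divff// gt_eqF// (row_limit_gt0 eqS).
Qed.

Lemma mass_flow (A : {set 'I_p}) (B : {set 'I_q}) :
    (forall i j, S i j != 0 -> i \in A -> j \in B) ->
  mass a A = \sum_(j in B) \sum_(i in A) S i j.
Proof.
move=> AB; rewrite exchange_big; apply: eq_bigr => i iA.
rewrite -(flow_row eqS) /row_sum [RHS]big_mkcond; apply: eq_bigr => j _.
case: ifPn => // jB; apply/eqP; apply: contraNT jB => Sij.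
exact: AB Sij iA.
Qed.

Lemma mass_flow_le (A : {set 'I_p}) (B : {set 'I_q}) :
    (forall i j, S i j != 0 -> i \in A -> j \in B) ->
  mass a A <= \sum_(j in B) b j * v j.
Proof.
move=> AB; rewrite (mass_flow AB); apply: ler_sum => j _.
rewrite -(flow_col eqS) /col_sum [leRHS](bigID (mem A)) /= lerDl.
by apply: sumr_ge0 => i _; apply: (flow_ge0 eqS).
Qed.

Lemma mass_flow_eq (A : {set 'I_p}) (B : {set 'I_q}) :
    (forall i j, S i j != 0 -> (i \in A) = (j \in B)) ->
  mass a A = \sum_(j in B) b j * v j.
Proof.
move=> AB; rewrite (@mass_flow A B); last by move=> i j /AB->.
apply: eq_bigr => j jB; rewrite -(flow_col eqS) /col_sum big_mkcond.
apply: eq_bigr => i _; case: ifPn => // iA; apply/esym/eqP.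
by apply: contraNT iA => /AB->.
Qed.

Variable l : R.
Hypothesis l_gt0 : 0 < l.

Let P : {set 'I_p} := [set i | l <= u i].
Let Q : {set 'I_q} := [set j | v j <= l^-1].
Let I : {set 'I_p} := [set i | u i == l].
Let J : {set 'I_q} := [set j | v j == l^-1].

Let flow_PQ i j : S i j != 0 -> (i \in P) = (j \in Q).
Proof.
by move=> /flow_colE vE; rewrite !inE vE lef_pV2 ?posrE// (row_limit_gt0 eqS).
Qed.

Let flow_IJ i j : S i j != 0 -> (i \in I) = (j \in J).
Proof.
by move=> /flow_colE vE; rewrite !inE vE (inj_eq invr_inj).
Qed.

Let sub_IP : I \subset P.
Proof. by apply/subsetP => i; rewrite !inE => /eqP->. Qed.

Let sub_JQ : J \subset Q.
Proof. by apply/subsetP => i; rewrite !inE => /eqP->. Qed.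

(** When [l] is the largest value of [u], the columns of Q all have ratio 1 / l,
    so the normalized restriction of [S] has column sums proportional to b. *)
Lemma top_restricted_solution : (forall i, u i <= l) ->
  restricted_solution a b X P Q (\matrix_(i, j) (S i j / mass a P)).
Proof.
move=> u_le; have v_eq j : v j = l^-1 \/ j \notin Q.
  have [i Sij] := col_source j; rewrite -(flow_PQ Sij) inE (flow_colE Sij).
  by have := u_le i; rewrite le_eqVlt => /predU1P[->|]; [left|right; rewrite -ltNge].
have mP : mass a P = mass b Q / l.
  rewrite (mass_flow_eq flow_PQ) mulr_suml; apply: eq_bigr => j jQ.
  by have [->//|/negP[]] := v_eq j.
split=> [i j _ _|i iP|j jQ|i j _ _ X0].
- rewrite mxE divr_ge0 ?(flow_ge0 eqS)//; apply: sumr_ge0 => k _; exact: ltW.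
- under eq_bigr do rewrite mxE.
  rewrite -mulr_suml -(flow_row eqS) /row_sum big_mkcond; congr (_ / _).
  apply: eq_bigr => j _; case: ifPn => // jQ; apply/esym/eqP.
  by apply: contraNT jQ => /flow_PQ<-.
- under eq_bigr do rewrite mxE.
  rewrite -mulr_suml; have -> : \sum_(i in P) S i j = b j / l.
    have [<-|/negP[]//] := v_eq j; rewrite -(flow_col eqS) big_mkcond.
    apply: eq_bigr => i _; case: ifPn => // iP; apply/esym/eqP.
    by apply: contraNT iP => /flow_PQ->.
  by rewrite mP invf_div mulrA divfK// gt_eqF.
- rewrite mxE; have [->|/(flow_supp eqS)] := eqVneq (S i j) 0.
    by rewrite mul0r.
  by rewrite X0 eqxx.
Qed.

Let mass_I : mass a I = mass b J / l.
Proof.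
rewrite (mass_flow_eq flow_IJ) mulr_suml; apply: eq_bigr => j.
by rewrite inE => /eqP->.
Qed.

Let null_flow (A : {set 'I_p}) (B : {set 'I_q}) : A \subset P ->
    (forall i j, i \in A -> j \in B -> X i j = 0) ->
  forall i j, S i j != 0 -> i \in A -> j \in Q :\: B.
Proof.
move=> /subsetP AP AB i j Sij iA; rewrite inE -(flow_PQ Sij) AP// andbT.
by apply/negP => jB; move: (flow_supp eqS Sij); rewrite AB ?eqxx.
Qed.

(** [S] must send [A] into the part of Q outside [B], where v_j <= 1 / l. *)
Lemma null_mass_le (A : {set 'I_p}) (B : {set 'I_q}) : A \subset P ->
    (forall i j, i \in A -> j \in B -> X i j = 0) ->
  mass a A <= mass b (Q :\: B) / l.
Proof.
move=> AP AB; apply: le_trans (mass_flow_le (null_flow AP AB)) _.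
rewrite mulr_suml; apply: ler_sum => j; rewrite !inE => /andP[_ v_le].
by rewrite ler_pM2l.
Qed.

(** Equality forces v_j = 1 / l on the whole of Q \ B; as [S] sends [A] there,
    u = l on [A]. *)
Lemma null_mass_eq (A : {set 'I_p}) (B : {set 'I_q}) : A \subset P ->
    (forall i j, i \in A -> j \in B -> X i j = 0) ->
    mass a A = mass b (Q :\: B) / l ->
  A \subset I /\ Q :\: J \subset B.
Proof.
move=> AP AB mE; have flow := null_flow AP AB.
have QBJ j : j \in Q :\: B -> j \in J.
  move=> jQB; rewrite inE; apply: contraT => vj_neq.
  suff : mass a A < mass b (Q :\: B) / l by rewrite mE ltxx.
  apply: le_lt_trans (mass_flow_le flow) _.
  rewrite /mass mulr_suml; apply: (ltr_sum_one jQB) => [|k].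
    by rewrite ltr_pM2l// lt_neqAle vj_neq; move: jQB; rewrite !inE => /andP[].
  by rewrite !inE => /andP[_ v_le]; rewrite ler_pM2l.
split; [apply/subsetP => i iA|apply/subsetP => j].
  have [j Sij] := row_target i; rewrite (flow_IJ Sij); exact/QBJ/(flow _ _ Sij).
rewrite inE => /andP[jJ jQ]; apply: contraNT jJ => jB.
by apply: QBJ; rewrite inE jB.
Qed.

(** The extended ratio of a cause is finite: the rows of [A] send a positive mass
    into Q \ B. *)
Lemma cause_ratioE (A : {set 'I_p}) (B : {set 'I_q}) :
    incompatibility_cause a b X P Q A B ->
  cause_ratio a b Q A B = (mass a A / mass b (Q :\: B))%:E /\
  0 < mass b (Q :\: B).
Proof.
move=> [[AP /set0Pn[i iA]] _ AB _].
have [j Sij] := row_target i.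
have m_gt0 : 0 < mass b (Q :\: B).
  by apply: (mass_gt0 b_gt0 (i := j)); apply: null_flow AP AB _ _ Sij iA.
by split=> //; rewrite /cause_ratio inver gt_eqF// -EFinM.
Qed.

(** By the two mass estimates the ratio of a cause is at most 1 / l, a value
    attained by I x (Q \ J).  A row with u > l makes this rectangle a genuine
    cause: it lowers the mean of v on Q strictly below 1 / l, its value on J. *)
Lemma block_maximizing_cause : (exists i, u i = l) -> (exists i, l < u i) ->
  ratio_maximizing_cause a b X P Q I (Q :\: J) /\
  forall A B, ratio_maximizing_cause a b X P Q A B ->
    A \subset I /\ Q :\: J \subset B.
Proof.
move=> [i0 ui0] [i1 ui1].
have i0I : i0 \in I by rewrite inE ui0.
have [j0 Sij0] := row_target i0; have [j1 Sij1] := row_target i1.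
have j0J : j0 \in J by rewrite -(flow_IJ Sij0).
have j1Q : j1 \in Q by rewrite -(flow_PQ Sij1) inE ltW.
have j1J : j1 \notin J by rewrite -(flow_IJ Sij1) inE gt_eqF.
have QQJ : Q :\: (Q :\: J) = J by rewrite setDDr setDv set0U; apply/setIidPr.
have mJ_gt0 : 0 < mass b J by apply: mass_gt0 j0J.
have mQ_gt0 : 0 < mass b Q by apply: mass_gt0 j1Q.
have mP_gt0 : 0 < mass a P by apply: mass_gt0 (subsetP sub_IP _ i0I).
have null_IJ i j : i \in I -> j \in Q :\: J -> X i j = 0.
  rewrite !inE => /eqP ui /andP[vj v_le]; apply/eqP; apply: contraNT vj.
  move=> /(supp_ge1 eqS); rewrite ui mulrC -ler_pdivrMr// mul1r => v_ge.
  by rewrite eq_le v_le.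
have mP_lt : mass a P < mass b Q / l.
  rewrite (mass_flow_eq flow_PQ) /mass mulr_suml.
  apply: (ltr_sum_one j1Q) => [|j]; last by rewrite inE ler_pM2l.
  by rewrite ltr_pM2l// lt_neqAle; move: j1J j1Q; rewrite !inE => ->.
have IJcause : incompatibility_cause a b X P Q I (Q :\: J).
  split=> //.
  - by split; [|apply/set0Pn; exists i0].
  - by split; [apply: subsetDl|apply/set0Pn; exists j1; rewrite inE j1J].
  - rewrite QQJ mass_I ltr_pdivlMr// mulrAC ltr_pdivrMr//.
    by rewrite -mulrA ltr_pM2l// mulrC.
have IJratio : cause_ratio a b Q I (Q :\: J) = (l^-1)%:E.
  have [-> _] := cause_ratioE IJcause.
  by rewrite QQJ mass_I mulrAC divff ?mul1r// gt_eqF.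
split=> [|A B [ABcause AB_max]].
  split=> // A B ABcause; rewrite IJratio.
  have [-> mB_gt0] := cause_ratioE ABcause.
  have [[AP _] _ AB _] := ABcause.
  by rewrite lee_fin ler_pdivrMr// mulrC (null_mass_le AP AB).
have [[AP _] _ AB _] := ABcause.
apply: null_mass_eq => //; apply/eqP; rewrite eq_le (null_mass_le AP AB).
have := AB_max _ _ IJcause; rewrite IJratio.
have [-> mB_gt0] := cause_ratioE ABcause.
by rewrite lee_fin ler_pdivlMr// mulrC.
Qed.

End Blocks.

End Ipfp.

(** * Identification of the blocks *)

Theorem theorem5 (R : realType) (p q : nat) (hp : (2 <= p)%N) (hq : (2 <= q)%N)
    (a : 'I_p -> R) (b : 'I_q -> R)
    (a_gt0 : forall i, 0 < a i) (b_gt0 : forall j, 0 < b j)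
    (a_sum1 : \sum_(i < p) a i = 1) (b_sum1 : \sum_(j < q) b j = 1)
    (X0 : 'M[R]_(p, q)) (hX0 : Gamma1 X0)
    (incompatible :
       ~ exists S : 'M[R]_(p, q), Gamma a b S /\ Supp S \subset Supp X0)
    (k : nat) (hk : (k < nblocks a b X0)%N) :
  let P := Prest a b X0 k in
  let Q := Qrest a b X0 k in
  (k.+1 = nblocks a b X0 ->
     exists S : 'M[R]_(p, q), restricted_solution a b X0 P Q S) /\
  ((k.+1 < nblocks a b X0)%N ->
     let Ak := Iblock a b X0 k in
     let Bk := Q :\: Jblock a b X0 k in
     ratio_maximizing_cause a b X0 P Q Ak Bk /\
     forall (A : {set 'I_p}) (B : {set 'I_q}),
       ratio_maximizing_cause a b X0 P Q A B ->
       A \subset Ak /\ Bk \subset B).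
Proof.
have [gX _] := hX0.
have a_le1 i : a i <= 1.
  by rewrite -a_sum1 (bigD1 i)//= lerDl sumr_ge0// => i' _; apply: ltW.
have [S [u [v eqS]]] := exists_equilibrium a_gt0 b_gt0 gX a_le1.
have uE i := lim_row_ratioE a_gt0 b_gt0 gX eqS a_sum1 b_sum1 i.
have vE j := lim_col_ratioE a_gt0 b_gt0 gX eqS a_sum1 b_sum1 j.
set s := lambdas a b X0; pose l := s`_k.
have s_lt : sorted <%R s by rewrite sort_lt_sorted undup_uniq.
have s_mem x : (x \in s) = (x \in [seq u i | i <- enum 'I_p]).
  by rewrite mem_sort mem_undup (eq_map uE).
have u_s i : u i \in s by rewrite s_mem map_f// mem_enum.
have s_u x : x \in s -> exists i, u i = x.
  by rewrite s_mem => /mapP[i _ ->]; exists i.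
have v_s j : (v j)^-1 \in s.
  have [i Sij] := col_source b_gt0 eqS j.
  by rewrite (flow_colE eqS Sij) invrK.
have l_s : l \in s by rewrite mem_nth.
have l_gt0 : 0 < l by have [i <-] := s_u _ l_s; apply: (row_limit_gt0 eqS).
have PE : Prest a b X0 k = [set i | l <= u i].
  apply/setP => i; rewrite !inE; apply/idP/(lt_sorted_nth_le s_lt hk (u_s i)).
    move=> /bigcupP i_out m mk; apply/negP => ui; apply: i_out.
    by exists (Ordinal mk); rewrite // inE uE.
  by move=> u_neq; apply/bigcupP => -[[m mk] _]; rewrite inE uE (negPf (u_neq _ mk)).
have QE : Qrest a b X0 k = [set j | v j <= l^-1].
  apply/setP => j; rewrite !inE.
  have -> : (v j <= l^-1) = (l <= (v j)^-1).
    by rewrite -[v j in LHS]invrK lef_pV2 ?posrE ?invr_gt0 ?(col_limit_gt0 eqS).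
  apply/idP/(lt_sorted_nth_le s_lt hk (v_s j)).
    move=> /bigcupP j_out m mk; apply/negP => vj; apply: j_out.
    by exists (Ordinal mk); rewrite // inE vE -(inj_eq invr_inj) invrK.
  move=> v_neq; apply/bigcupP => -[[m mk] _].
  by rewrite inE vE -(inj_eq invr_inj) invrK (negPf (v_neq _ mk)).
have IE : Iblock a b X0 k = [set i | u i == l].
  by apply/setP => i; rewrite !inE uE.
have JE : Jblock a b X0 k = [set j | v j == l^-1].
  by apply/setP => j; rewrite !inE vE.
rewrite /= PE QE IE JE; split=> [k_last|k_lt].
  exists (\matrix_(i, j) (S i j / mass a [set i | l <= u i])).
  apply: (top_restricted_solution a_gt0 b_gt0 eqS l_gt0) => i; rewrite /l.
  rewrite -(nth_index 0 (u_s i)) lt_sorted_leq_nth//.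
    by rewrite -ltnS k_last index_mem.
  by rewrite inE index_mem.
apply: (block_maximizing_cause a_gt0 b_gt0 eqS l_gt0); first exact: s_u _ l_s.
have [i ui] := s_u _ (mem_nth 0 k_lt); exists i.
by rewrite ui lt_sorted_ltn_nth// inE.
Qed.
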